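(* Let $\Gamma$ be a finite nonabelian group. For a matroid $M$ the following are equivalent: (1) $M$ is representable over $\Gamma$; (2) $M$ does not have $U_{2,3}$ as a minor; (3) the simplification of $M$ is $U_{n,n}$ for some $n$, or $M$ consists entirely of loops; (4) $M$ is representable over every finite group.
   Context: A polymatroid is a pair $(E,r)$, $E$ finite, $r:2^E\to\mathbb{R}_{\ge0}$ with $r(\emptyset)=0$, $r$ monotone, and $r(S)+r(T)\ge r(S\cup T)+r(S\cap T)$. A matroid is a polymatroid with integer-valued rank function satisfying $r(S)\le|S|$ for all $S$. Two polymatroids $(E,r),(E',r')$ are isomorphic if there is a bijection $E\to E'$ preserving rank. For a finite group $\Gamma$, a finite set $E'$ and a subgroup $\mathcal{H}\le\Gamma^{E'}$, let $P(\mathcal{H})=(E',r_{\mathcal{H}})$ where $r_{\mathcal{H}}(S)=\log_{|\Gamma|}|\pi_S(\mathcal{H})|$, with $\pi_S:\Gamma^{E'}\to\Gamma^S$ the coordinate projection ($\pi_\emptyset(\mathcal H)$ trivial). A polymatroid is representable over $\Gamma$ if it is isomorphic to $P(\mathcal{H})$ for some finite $E'$ and some subgroup $\mathcal{H}\le\Gamma^{E'}$. For $S\subseteq E$, the deletion $P\setminus S$ has ground set $E-S$ and rank $r$ restricted; the contraction $P/S$ has ground set $E-S$ and rank $T\mapsto r(S\cup T)-r(S)$; a minor is obtained by a sequence of deletions and contractions. $U_{d,n}$ is the matroid on $[n]$ with $r(S)=\min(d,|S|)$. A loop is an element $x$ with $r(\{x\})=0$; distinct $x,y$ are parallel if $0<r(\{x\})=r(\{y\})=r(\{x,y\})$;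 the simplification of a matroid is obtained by deleting all loops and all but one element of each parallel class. *)

(* Defs.v *)
From HB Require Import structures.
From mathcomp Require Import all_boot all_order all_algebra all_fingroup.
From mathcomp Require Import reals exp.

Set Implicit Arguments.
Unset Strict Implicit.
Unset Printing Implicit Defensive.

Import Order.TTheory GRing.Theory Num.Theory.
Local Open Scope ring_scope.

Record polymatroid (R : realType) := Polymatroid {
  ground :> finType;
  rank : {set ground} -> R;
  rank_ge0 : forall S, 0 <= rank S;
  rank0 : rank set0 = 0;
  rank_mono : forall S T : {set ground}, S \subset T -> rank S <= rank T;
  rank_submod : forall S T : {set ground},
    rank (S :|: T) + rank (S :&: T) <= rank S + rank T }.

Arguments rank {R} M S : rename.

Definition is_matroid (R : realType) (M : polymatroid R) : Prop :=
  forall S : {set M}, rank M S \is a Num.int /\ rank M S <= #|S|%:R.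

Definition isomorphic (R : realType) (M N : polymatroid R) : Prop :=
  exists f : M -> N, bijective f /\ forall S : {set M}, rank N (f @: S) = rank M S.

Section Minors.
Variables (R : realType) (M : polymatroid R) (S : {set M}).

(* The ground set E - S, as a subtype of E. *)
Let E' := {x : M | x \notin S}.
Let up (T : {set E'}) : {set M} := [set val x | x in T].

Let delete_rank (T : {set E'}) : R := rank M (up T).
Let contract_rank (T : {set E'}) : R := rank M (S :|: up T) - rank M S.

Let upU T U : up (T :|: U) = up T :|: up U.
Proof. exact: imsetU. Qed.

Let upI T U : up (T :&: U) = up T :&: up U.
Proof. by apply: imsetI => x y _ _; apply: val_inj. Qed.

Fact delete_rank0 : delete_rank set0 = 0.
Proof. by rewrite /delete_rank /up imset0 rank0. Qed.

Fact delete_rank_mono (T U : {set E'}) : T \subset U -> delete_rank T <= delete_rank U.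
Proof. by move=> TU; apply/rank_mono/imsetS. Qed.

Fact delete_rank_submod T U :
  delete_rank (T :|: U) + delete_rank (T :&: U) <= delete_rank T + delete_rank U.
Proof. by rewrite /delete_rank upU upI rank_submod. Qed.

Definition delete : polymatroid R :=
  Polymatroid (fun T => rank_ge0 (up T)) delete_rank0 delete_rank_mono
    delete_rank_submod.

Fact contract_rank_ge0 T : 0 <= contract_rank T.
Proof. by rewrite subr_ge0; apply/rank_mono/subsetUl. Qed.

Fact contract_rank0 : contract_rank set0 = 0.
Proof. by rewrite /contract_rank /up imset0 setU0 subrr. Qed.

Fact contract_rank_mono (T U : {set E'}) :
  T \subset U -> contract_rank T <= contract_rank U.
Proof. by move=> TU; rewrite lerB//; apply/rank_mono/setUS/imsetS. Qed.

Fact contract_rank_submod T U :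
  contract_rank (T :|: U) + contract_rank (T :&: U) <=
  contract_rank T + contract_rank U.
Proof.
rewrite /contract_rank addrACA [leRHS]addrACA lerD2r upU upI setUIr.
by rewrite -{1}[S]setUid setUACA rank_submod.
Qed.

Definition contract : polymatroid R :=
  Polymatroid contract_rank_ge0 contract_rank0 contract_rank_mono
    contract_rank_submod.

End Minors.

Inductive minor (R : realType) (M : polymatroid R) : polymatroid R -> Prop :=
| minor_refl : minor M M
| minor_delete (N : polymatroid R) (S : {set N}) : minor M N -> minor M (delete S)
| minor_contract (N : polymatroid R) (S : {set N}) : minor M N -> minor M (contract S).

Definition has_minor (R : realType) (M N : polymatroid R) : Prop :=
  exists2 N' : polymatroid R, minor M N' & isomorphic N' N.

Section Uniform.
Variables (R : realType) (d n : nat).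

Let uniform_rank (S : {set 'I_n}) : R := (minn d #|S|)%:R.

Fact uniform_rank0 : uniform_rank set0 = 0.
Proof. by rewrite /uniform_rank cards0 minn0. Qed.

Fact uniform_rank_mono (S T : {set 'I_n}) : S \subset T -> uniform_rank S <= uniform_rank T.
Proof.
move=> /subset_leq_card ST; rewrite ler_nat leq_min geq_minl /=.
exact: leq_trans (geq_minr _ _) ST.
Qed.

Fact uniform_rank_submod S T :
  uniform_rank (S :|: T) + uniform_rank (S :&: T) <=
  uniform_rank S + uniform_rank T.
Proof.
rewrite -!natrD ler_nat.
have cUI := cardsUI S T.
have IS : (#|S :&: T| <= #|S|)%N by apply/subset_leq_card/subsetIl.
have IT : (#|S :&: T| <= #|T|)%N by apply/subset_leq_card/subsetIr.
have IleT : (minn d #|S :&: T| <= minn d #|T|)%N.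
  by rewrite leq_min geq_minl (leq_trans (geq_minr _ _)).
have IleS : (minn d #|S :&: T| <= minn d #|S|)%N.
  by rewrite leq_min geq_minl (leq_trans (geq_minr _ _)).
have [dS|Sd] := leqP d #|S|; first by apply: leq_add; rewrite ?geq_minl.
have [dT|Td] := leqP d #|T|.
  by rewrite addnC; apply: leq_add; rewrite ?geq_minl// (leq_trans IleS)// geq_minr.
by rewrite -cUI leq_add ?geq_minr.
Qed.

Definition uniform : polymatroid R :=
  @Polymatroid R 'I_n uniform_rank (fun S => ler0n _ _) uniform_rank0
    uniform_rank_mono uniform_rank_submod.

End Uniform.

Section Simplification.
Variables (R : realType) (M : polymatroid R).

Definition loop (x : M) : bool := rank M [set x] == 0.

Definition parallel (x y : M) : bool :=
  [&& x != y, 0 < rank M [set x], rank M [set x] == rank M [set y]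
    & rank M [set y] == rank M [set x; y]].

Definition nonloops : {set M} := [set x | ~~ loop x].

Definition parallel_classes : {set {set M}} :=
  equivalence_partition (fun x y => (x == y) || parallel x y) nonloops.

(* Only meaningful for matroids: being equal or parallel need not be transitive
   on a general polymatroid. *)
Definition simplification : polymatroid R :=
  delete (~: transversal parallel_classes nonloops).

End Simplification.

(* The library gives {ffun E -> gT} a pointwise group structure and a finType
   structure, but not their join finGroupType. *)
HB.instance Definition _ (E : finType) (gT : finGroupType) :=
  Finite.on {ffun E -> gT}.

Section GroupPolymatroid.
Variables (R : realType) (gT : finGroupType) (E : finType).

Definition proj (S : {set E}) (h : {ffun E -> gT}) :
    {ffun {x : E | x \in S} -> gT} :=
  [ffun x => h (val x)].

Fact projM S : {morph proj S : g h / (g * h)%g}.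
Proof. by move=> g h; apply/ffunP => x; rewrite !ffunE. Qed.

Variable H : {group {ffun E -> gT}}.

(* The logarithm to base #|gT|. For the trivial group the base is 1 and this is
   the junk value 0 / 0 = 0. *)
Let group_rank (S : {set E}) : R :=
  ln #|proj S @: H|%:R / ln #|[set: gT]|%:R.

Let K (S : {set E}) : {set {ffun E -> gT}} :=
  [set h in H | [forall x in S, h x == 1%g]].

Fact K_group_set S : group_set (K S).
Proof.
apply/group_setP; split=> [|g h].
  by rewrite inE group1; apply/forall_inP => x _; rewrite ffunE.
rewrite !inE => /andP[Hg /forall_inP g1] /andP[Hh /forall_inP h1].
rewrite groupM//=; apply/forall_inP => x xS.
by rewrite ffunE (eqP (g1 _ xS)) (eqP (h1 _ xS)) mulg1.
Qed.

Let KG S := Group (K_group_set S).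

Fact card_proj S : (#|proj S @: H| * #|K S|)%N = #|H|.
Proof.
have dM : {in [set: {ffun E -> gT}] &, {morph proj S : g h / (g * h)%g}}.
  by move=> g h _ _; exact: projM.
pose f := Morphism dM.
have -> : proj S @: H = (f @* H)%g by rewrite morphimEsub// subsetT.
have -> : K S = ('ker_H f)%g.
  apply/setP => h; rewrite !inE; congr (_ && _); apply/forall_inP/eqP => /=.
    by move=> h1; apply/ffunP => x; rewrite !ffunE (eqP (h1 _ (valP x))).
  by move=> /ffunP h1 x xS; have := h1 (exist _ x xS); rewrite !ffunE => /= ->.
by rewrite card_morphim setTI mulnC LagrangeI.
Qed.

Let card_proj_gt0 S : (0 < #|proj S @: H|)%N.
Proof. by rewrite card_gt0 imset_eq0; apply/set0Pn; exists 1%g; exact: group1. Qed.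

Let lnE (n m : nat) : (0 < n <= m)%N -> ln n%:R <= ln m%:R :> R.
Proof.
case/andP => n0 nm.
by rewrite ler_ln ?ler_nat// posrE ltr0n// (leq_trans n0).
Qed.

Let log_ge0 : 0 <= ln #|[set: gT]|%:R :> R.
Proof. by rewrite ln_ge0// ler1n card_gt0; apply/set0Pn; exists 1%g; rewrite inE. Qed.

Fact group_rank_ge0 S : 0 <= group_rank S.
Proof. by rewrite divr_ge0// ln_ge0// ler1n. Qed.

Fact group_rank0 : group_rank set0 = 0.
Proof.
have := card_proj set0.
have -> : K set0 = H.
  by apply/setP => h; rewrite !inE; case: (h \in H) => //=; apply/forall_inP => x; rewrite inE.
move=> /eqP; rewrite -{2}[#|H|]mul1n eqn_pmul2r// => /eqP c1.
by rewrite /group_rank c1 ln1 mul0r.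
Qed.

Fact group_rank_mono (S T : {set E}) : S \subset T -> group_rank S <= group_rank T.
Proof.
move=> ST; rewrite ler_wpM2r ?invr_ge0// lnE// card_proj_gt0 /=.
have KTS : (#|K T| <= #|K S|)%N.
  apply/subset_leq_card/subsetP => h; rewrite !inE => /andP[-> /forall_inP h1].
  by apply/forall_inP => x /(subsetP ST) /h1.
rewrite -(leq_pmul2r (cardG_gt0 (KG S))) /= card_proj -(card_proj T).
by rewrite leq_pmul2l.
Qed.

Fact group_rank_submod S T :
  group_rank (S :|: T) + group_rank (S :&: T) <= group_rank S + group_rank T.
Proof.
rewrite -!mulrDl ler_wpM2r ?invr_ge0//.
rewrite -!lnM ?posrE ?ltr0n// -!natrM lnE// muln_gt0 !card_proj_gt0 /=.
have KU : K (S :|: T) = K S :&: K T.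
  apply/setP => h; rewrite !inE; case: (h \in H) => //=.
  apply/forall_inP/andP => [h1|[/forall_inP hS /forall_inP hT] x].
    by split; apply/forall_inP => x xS; apply: h1; rewrite inE xS ?orbT.
  by rewrite inE => /orP[/hS|/hT].
have KI : (#|K S| * #|K T| <= #|K (S :&: T)| * #|K (S :|: T)|)%N.
  have /= -> := mul_cardG (KG S) (KG T).
  rewrite KU leq_mul2r; apply/orP; right.
  apply/subset_leq_card/subsetP => _ /mulsgP[g h + + ->].
  rewrite !inE => /andP[Hg /forall_inP g1] /andP[Hh /forall_inP h1].
  rewrite groupM//=; apply/forall_inP => x; rewrite inE => /andP[xS xT].
  by rewrite ffunE (eqP (g1 _ xS)) (eqP (h1 _ xT)) mulg1.
have p0 : (0 < #|K S| * #|K T|)%N.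
  by rewrite muln_gt0 (cardG_gt0 (KG S)) (cardG_gt0 (KG T)).
rewrite -(leq_pmul2r p0) [leqRHS]mulnACA !card_proj.
apply: leq_trans (leq_mul (leqnn _) KI) _.
by rewrite [X in (_ * X <= _)%N]mulnC mulnACA !card_proj.
Qed.

Definition group_polymatroid : polymatroid R :=
  Polymatroid group_rank_ge0 group_rank0 group_rank_mono group_rank_submod.

End GroupPolymatroid.

Definition representable (R : realType) (gT : finGroupType)
    (M : polymatroid R) : Prop :=
  exists (E : finType) (H : {group {ffun E -> gT}}),
    isomorphic M (group_polymatroid R H).

(* Main.v *)
(* Representability passes to minors, and a representation of U_{2,3} over a
   group forces it to be abelian: two commuting subgroups both project onto it.
   A matroid without U_{2,3} minor has free simplification, since otherwise a
   circuit of the simplification contracts to U_{2,3}. Conversely, if the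
   simplification is free, the functions that are trivial on loops and constant
   on parallel classes represent the matroid over any nontrivial group. *)
Require Import Defs.
From mathcomp Require Import all_boot all_order all_algebra all_fingroup.
From mathcomp Require Import reals exp.

Set Implicit Arguments.
Unset Strict Implicit.
Unset Printing Implicit Defensive.

Import Order.TTheory GRing.Theory Num.Theory.
Local Open Scope ring_scope.

(** * Kernels of coordinate projections, whose orders encode the ranks *)

Section CoordinateKernel.
Variables (gT : finGroupType) (E : finType) (H : {group {ffun E -> gT}}).

Definition coord_ker (S : {set E}) : {set {ffun E -> gT}} :=
  [set h in H | [forall x in S, h x == 1%g]].

Canonical coord_ker_group S := Group (K_group_set H S).

Lemma coord_kerP (S : {set E}) (h : {ffun E -> gT}) :
  reflect (h \in H /\ {in S, forall x, h x = 1%g}) (h \in coord_ker S).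
Proof.
rewrite inE; apply: (iffP andP) => -[hH].
  by move/forall_inP => h1; split=> // x /h1/eqP.
by move=> h1; split=> //; apply/forall_inP => x /h1/eqP.
Qed.

Lemma rank_group (R : realType) (S : {set E}) :
  rank (group_polymatroid R H) S =
  (ln #|H|%:R - ln #|coord_ker S|%:R) / ln #|[set: gT]|%:R.
Proof.
rewrite -(card_proj H S) natrM lnM ?posrE ?ltr0n ?addrK ?cardG_gt0//.
by rewrite card_gt0 imset_eq0; apply/set0Pn; exists 1%g; exact: group1.
Qed.

(** An integral rank turns the logarithmic formula into an exact count, because [ln] is injective on
    positive reals. *)
Lemma card_coord_ker (R : realType) S k : (1 < #|[set: gT]|)%N ->
  rank (group_polymatroid R H) S = k%:R ->
  #|H| = (#|coord_ker S| * #|[set: gT]| ^ k)%N.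
Proof.
move=> q1; have q0 : (0 < #|[set: gT]|)%N by apply: ltn_trans q1.
have lnq : 0 < ln #|[set: gT]|%:R :> R by rewrite ln_gt0// ltr1n.
rewrite rank_group => /(canRL (divfK (lt0r_neq0 lnq)))/eqP.
rewrite subr_eq mulr_natl -lnXn ?ltr0n// -natrX.
rewrite -lnM ?posrE ?ltr0n ?expn_gt0 ?q0 ?cardG_gt0// -natrM => /eqP.
move/ln_inj; rewrite !posrE !ltr0n muln_gt0 expn_gt0 q0 !cardG_gt0 mulnC.
by move=> /(_ isT isT)/eqP; rewrite eqr_nat => /eqP.
Qed.

End CoordinateKernel.

Lemma coord_ker_coord_ker (gT : finGroupType) (E : finType)
    (H : {group {ffun E -> gT}}) (S T : {set E}) :
  coord_ker (coord_ker_group H S) T = coord_ker H (S :|: T).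
Proof.
apply/setP => h; apply/coord_kerP/coord_kerP => [[/coord_kerP[hH hS] hT]|[hH h1]].
  by split=> // x /setUP[/hS|/hT].
split=> [|x xT]; last by apply: h1; rewrite inE xT orbT.
by apply/coord_kerP; split=> // x xS; apply: h1; rewrite inE xS.
Qed.

(* A form of representability where elements of [M] may share a coordinate and
   coordinates may be unused, which makes it visibly closed under minors. *)
Definition coordinatized (R : realType) (gT : finGroupType) (M : polymatroid R) :=
  exists (E : finType) (H : {group {ffun E -> gT}}) (j : M -> E),
    forall S, rank M S = rank (group_polymatroid R H) (j @: S).

Lemma representable_coordinatized (R : realType) (gT : finGroupType)
  (M : polymatroid R) : representable gT M -> coordinatized gT M.
Proof. by move=> [E [H [f [_ fr]]]]; exists E, H, f. Qed.

(** Deletion restricts [j]. Contraction of [S] replaces [H] by its kernel on [j @: S]: the terms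
    [ln #|H|] cancel in the difference of ranks. *)
Lemma coordinatized_minor (R : realType) (gT : finGroupType)
    (M N : polymatroid R) :
  minor M N -> coordinatized gT M -> coordinatized gT N.
Proof.
elim=> // {}N S _ IH /IH[E [H [j jr]]].
  by exists E, H, (j \o val) => T; rewrite imset_comp -jr.
exists E, (coord_ker_group H (j @: S)), (j \o val) => T.
have -> : rank (contract S) T = rank N (S :|: val @: T) - rank N S by [].
rewrite (imset_comp j val) !jr imsetU !rank_group coord_ker_coord_ker -mulrBl.
by rewrite opprB addrC addrA subrK.
Qed.

Lemma coordinatized_isomorphic (R : realType) (gT : finGroupType)
    (M N : polymatroid R) :
  isomorphic M N -> coordinatized gT M -> coordinatized gT N.
Proof.
move=> [f [[g fK gK] fr]] [E [H [j jr]]]; exists E, H, (j \o g) => S.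
rewrite imset_comp -jr -fr -imset_comp (eq_imset _ gK).
by rewrite imset_id.
Qed.

(* Modulo the kernel of all three coordinates, the subgroups of [H] killed by
   the first and by the second coordinate commute, and the third coordinate maps
   each of them onto the whole group. *)
Lemma coordinatized_U23_abelian (R : realType) (gT : finGroupType) :
  coordinatized gT (uniform R 2 3) -> abelian [set: gT].
Proof.
move=> [E [H [j jr]]].
have [q1|q1] := leqP #|[set: gT]| 1.
  by rewrite (card_le1_trivg q1) abelian1.
pose K (S : {set 'I_3}) := coord_ker_group H (j @: S).
have cK (S : {set 'I_3}) : #|H| = (#|K S| * #|[set: gT]| ^ minn 2 #|S|)%N.
  by apply: (card_coord_ker q1 (R := R)); rewrite -jr.
have KP (S : {set 'I_3}) h :
    reflect (h \in H /\ {in S, forall i : 'I_3, h (j i) = 1%g}) (h \in K S).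
  apply: (iffP (coord_kerP _ _ _)) => -[hH h1]; split=> //.
    by move=> i iS; apply: h1; exact: imset_f.
  by move=> _ /imsetP[i iS ->]; exact: h1.
have K_decr (S T : {set 'I_3}) : S \subset T -> K T \subset K S.
  move=> /subsetP ST; apply/subsetP => h /KP[hH h1]; apply/KP; split=> // i /ST.
  exact: h1.
have cardsI3 : #|[set: 'I_3]| = 3%N by rewrite cardsT card_ord.
(* Pairs already have full rank 2, so an element trivial at two coordinates is trivial at the
   third. *)
have K_top (S : {set 'I_3}) : #|S| = 2%N -> K S :=: K setT.
  move=> S2; apply/esym/eqP; rewrite eqEcard K_decr ?subsetT//=.
  have := cK S; rewrite S2 (cK setT) cardsI3 => /eqP.
  by rewrite eqn_pmul2r ?expn_gt0 ?(ltn_trans _ q1)// => /eqP->.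
have evM (k : 'I_3) : {in [set: {ffun E -> gT}] &,
    {morph (fun h : {ffun E -> gT} => h (j k)) : g h / (g * h)%g}}.
  by move=> g h _ _; rewrite ffunE.
(* The kernel of evaluation at [k] on [K [set i]] is [K [set i; k]], of index [#|gT|] since the rank
   grows from 1 to 2. *)
have ev_onto (i k : 'I_3) : i != k -> (Morphism (evM k) @* K [set i] = [set: gT])%g.
  move=> ik; apply/eqP; rewrite eqEcard subsetT andTb card_morphim setTI -indexgI.
  have -> : ('ker_(K [set i]) (Morphism (evM k)))%g = K [set i; k].
    apply/setP => h; apply/setIP/KP.
      move=> [/KP[hH hi] /kerP-/(_ (in_setT h)) hk].
      by split=> // l /set2P[->|->//]; apply: hi; rewrite inE.
    move=> [hH h1]; split; last first.
      by apply/kerP; rewrite ?in_setT//= h1// !inE eqxx orbT.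
    by apply/KP; split=> // l /set1P->; rewrite h1// !inE eqxx.
  rewrite -divgS ?K_decr ?subsetUl//.
  have := cK [set i; k]; rewrite (cK [set i]) cards2 ik cards1.
  rewrite -[minn 2 1]/1%N -[minn _ _]/2%N (expnS _ 1) mulnA => /eqP.
  rewrite eqn_pmul2r ?expn_gt0 ?(ltn_trans _ q1)// => /eqP->.
  by rewrite mulKn ?cardG_gt0.
apply/centsP => a _ b _.
have := in_setT a; rewrite -(ev_onto 0 2)// => /morphimP[/= g _ Kg ->].
have := in_setT b; rewrite -(ev_onto 1 2)// => /morphimP[/= h _ Kh ->].
have /KP[gH g0] := Kg; have /KP[hH h1] := Kh.
have evR k : ([~ g, h] k = [~ g k, h k])%g by rewrite /commg /conjg !ffunE.
(* The commutator dies at 0 with [g] and at 1 with [h], hence also at 2, where it is the commutator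
   of [a] and [b]. *)
have : [~ g, h]%g \in K [set 0; 1].
  apply/KP; split=> [|i /set2P[->|->]]; first by rewrite groupR.
    by rewrite evR g0 ?inE// comm1g.
  by rewrite evR h1 ?inE// commg1.
rewrite K_top ?cards2// => /KP[_ /(_ 2)]; rewrite in_setT => /(_ isT).
by rewrite evR => /eqP/commgP.
Qed.

(** * Elements that do not raise the rank *)

Section Polymatroid.
Variables (R : realType) (M : polymatroid R).
Implicit Types (S T : {set M}) (x y : M).

(** Elements of [T] are added one at a time, with submodularity applied to two sets whose
    intersection contains [S]. *)
Lemma rank_span S T : (forall y, y \in T -> rank M (y |: S) <= rank M S) ->
  rank M (S :|: T) = rank M S.
Proof.
rewrite -(set_enum T) => ST.
have {ST} : {in enum T, forall y, rank M (y |: S) <= rank M S}.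
  by move=> y yT; apply: ST; rewrite inE.
elim: (enum T) => [|y s IH] Ss; first by rewrite set_nil setU0.
apply/le_anti; rewrite [X in _ && X]rank_mono ?subsetUl// andbT.
rewrite -(lerD2r (rank M S)).
apply: le_trans (_ : rank M (S :|: [set:: s]) + rank M (y |: S) <= _).
  apply: le_trans (rank_submod _ _); apply: lerD; apply: rank_mono.
    by rewrite set_cons [y |: _]setUC setUA setUS// subsetUl.
  by rewrite subsetI subsetUl subsetUr.
rewrite IH => [|z zs]; last by apply: Ss; rewrite inE zs orbT.
by rewrite lerD2l Ss ?mem_head.
Qed.

Lemma rank_setU1_loop S x : loop x -> rank M (x |: S) <= rank M S.
Proof.
move=> /eqP x0; have := rank_submod [set x] S; rewrite x0 add0r.
by apply: le_trans; rewrite lerDl rank_ge0.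
Qed.

Lemma rank_setU1_span S x y : y \in S -> rank M [set x; y] = rank M [set y] ->
  rank M (x |: S) <= rank M S.
Proof.
move=> yS xy; rewrite -(lerD2l (rank M [set y])) -[in leRHS]xy [leLHS]addrC.
apply: le_trans (rank_submod _ _); apply: lerD; apply: rank_mono.
  by rewrite setSU// subsetUl.
by rewrite sub1set !inE eqxx orbT.
Qed.

Lemma isomorphic_uniform d n : #|M| = n ->
  (forall S, rank M S = (minn d #|S|)%:R) -> isomorphic M (uniform R d n).
Proof.
move=> Mn Md; exists (cast_ord Mn \o enum_rank); split=> [|S /=].
  apply: bij_comp (@enum_rank_bij _).
  by exists (cast_ord (esym Mn)); [exact: cast_ordK|exact: cast_ordKV].
rewrite card_imset ?Md//.
by apply: inj_comp; [exact: cast_ord_inj|exact: enum_rank_inj].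
Qed.

End Polymatroid.

(** * Parallel classes and independence in the simplification *)

Section Matroid.
Variables (R : realType) (M : polymatroid R).
Hypothesis M_matroid : is_matroid M.
Implicit Types (S T : {set M}) (x y z : M).

Lemma matroid_rank S : exists2 n : nat, rank M S = n%:R & (n <= #|S|)%N.
Proof.
have [rZ rS] := M_matroid S.
have /natrP[n rn] : rank M S \is a Num.nat by rewrite natrEint rZ rank_ge0.
by exists n => //; rewrite -(ler_nat R) -rn.
Qed.

Lemma rank_nonloop x : ~~ loop x -> rank M [set x] = 1.
Proof.
rewrite /loop; have [[|[|n]] -> //] := matroid_rank [set x].
  by rewrite eqxx.
by rewrite cards1.
Qed.

Lemma parallelE x y : ~~ loop x -> ~~ loop y ->
  (x == y) || parallel x y = (rank M [set x; y] == 1).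
Proof.
move=> x1 y1; rewrite /parallel !rank_nonloop// ltr01 eqxx /= [1 == _]eq_sym.
by have [->|] //= := eqVneq x y; rewrite setUid rank_nonloop// eqxx.
Qed.

Lemma parallel_equivalence :
  {in nonloops M & &, equivalence_rel (fun x y => (x == y) || parallel x y)}.
Proof.
(* Since [y] spans [x], exchanging [x] for [y] cannot lower the rank; used both ways, this gives
   transitivity. *)
have sub x y z : ~~ loop y -> rank M [set x; y] = 1 ->
    rank M [set x; z] <= rank M [set y; z].
  move=> y1 xy; apply: le_trans (rank_setU1_span (x := x) (y := y) _ _).
  - by rewrite rank_mono// setUS// subsetUr.
  - by rewrite !inE eqxx.
  - by rewrite xy rank_nonloop.
move=> x y z; rewrite !inE => x1 y1 z1; split; first by rewrite eqxx.
rewrite !parallelE// => /eqP xy; congr (_ == _); apply/le_anti.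
by rewrite !sub// setUC.
Qed.

(** The ground set of [simplification M], seen inside [M]. *)
Definition simple_part : {set M} := transversal (parallel_classes M) (nonloops M).

(** A retraction of the nonloops onto [simple_part], constant on parallel classes; the argument [x]
    of [transversal_repr] is a default value. *)
Definition simple_repr x : M :=
  transversal_repr x simple_part (pblock (parallel_classes M) x).

Let partP : partition (parallel_classes M) (nonloops M) :=
  equivalence_partitionP parallel_equivalence.

Let transP : is_transversal simple_part (parallel_classes M) (nonloops M) :=
  transversalP partP.

Lemma simple_part_nonloop : {subset simple_part <= nonloops M}.
Proof. exact/subsetP/(transversal_sub transP). Qed.

Let pblock_class x : x \in nonloops M ->
  pblock (parallel_classes M) x \in parallel_classes M.
Proof. by move=> xD; rewrite pblock_mem// (cover_partition partP). Qed.

Lemma simple_repr_part x : x \in nonloops M -> simple_repr x \in simple_part.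
Proof. by move=> /pblock_class; exact: (repr_mem_transversal transP). Qed.

Lemma simple_repr_id : {in simple_part, forall x, simple_repr x = x}.
Proof. by move=> x; exact: (pblockK transP). Qed.

Lemma rank_simple_repr x : x \in nonloops M -> rank M [set x; simple_repr x] = 1.
Proof.
move=> xD; have tD := simple_part_nonloop (simple_repr_part xD).
apply/eqP; rewrite -parallelE; try by move: xD tD; rewrite !inE.
rewrite -(pblock_equivalence_partition parallel_equivalence xD tD).
exact: (repr_mem_pblock transP x (pblock_class xD)).
Qed.

Lemma rank_simple_pair x y : x \in simple_part -> y \in simple_part ->
  x != y -> rank M [set x; y] != 1.
Proof.
move=> xX yX; apply: contraNneq => /eqP xy.
have xD := simple_part_nonloop xX; have yD := simple_part_nonloop yX.
have /def_pblock : y \in pblock (parallel_classes M) x.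
  rewrite (pblock_equivalence_partition parallel_equivalence)// parallelE//.
    by rewrite !inE in xD.
  by rewrite !inE in yD.
move=> /(_ _ (partition_trivIset partP) (pblock_class xD)) yx.
by rewrite -(pblockK transP x xX) -(pblockK transP x yX) yx.
Qed.

(** Both sides equal the rank of the union of [S] and its representatives: each set spans the other,
    loops adding nothing. *)
Lemma rank_simple_image S :
  rank M (simple_repr @: (S :&: nonloops M)) = rank M S.
Proof.
set D := nonloops M; set Y := simple_repr @: _.
rewrite -[RHS](rank_span (T := Y)) => [|_ /imsetP[x /setIP[xS xD] ->]].
  rewrite setUC rank_span// => x xS.
  have [xD|] := boolP (x \in D); last first.
    by rewrite inE negbK; exact: rank_setU1_loop.
  apply: (@rank_setU1_span _ _ _ _ (simple_repr x)).
    by rewrite imset_f// inE xS.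
  rewrite rank_simple_repr// rank_nonloop//.
  by have := simple_part_nonloop (simple_repr_part xD); rewrite inE.
apply: (rank_setU1_span xS); rewrite setUC rank_simple_repr// rank_nonloop//.
by rewrite inE in xD.
Qed.

(* A smallest dependent subset [C] of the simplification is a circuit with at
   least three elements; contracting all but three of them gives U_{2,3}. *)
Lemma simple_part_free : ~ has_minor M (uniform R 2 3) ->
  forall S, S \subset simple_part -> rank M S = #|S|%:R.
Proof.
move=> noU S0 S0X; apply/eqP/negPn/negP => S0dep.
pose dep := [pred S : {set M} | (S \subset simple_part) && (rank M S != #|S|%:R)].
have [|C /minsetP[/andP[CX Cdep] Cmin] _] := @minset_exists _ dep S0.
  by rewrite /= S0X.
have indep S : S \proper C -> rank M S = #|S|%:R.
  move=> /andP[SC CS]; apply/eqP; apply: contraNT CS => Sdep.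
  by rewrite (Cmin S)//= (subset_trans SC).
have C_gt0 : (0 < #|C|)%N.
  by rewrite card_gt0; apply: contraNneq Cdep => ->; rewrite cards0 rank0.
(* Dependence bounds the rank above, and the independence of [C] minus a point bounds it below. *)
have rC : rank M C = #|C|.-1%:R.
  have /card_gt0P[x xC] := C_gt0.
  have [n rn] := matroid_rank C.
  rewrite leq_eqVlt => /orP[/eqP nC|nC]; first by rewrite rn nC eqxx in Cdep.
  have := rank_mono (subD1set C x).
  rewrite indep ?properD1// rn ler_nat; have := cardsD1 x C; rewrite xC add1n => cC.
  by move: nC; rewrite cC ltnS /= => n1 n2; congr _%:R; apply/eqP; rewrite eqn_leq n1.
(* A circuit of size one would be a loop, and one of size two a parallel pair. *)
have C_ge3 : (2 < #|C|)%N.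
  rewrite ltnNge; apply/negP => C2.
  have : (#|C| == 1%N) || (#|C| == 2%N) by move: C_gt0 C2; case: #|C| => [|[|[]]].
  case/orP => [/cards1P[x Cx]|/cards2P[x [y [xy Cxy]]]].
    have /simple_part_nonloop : x \in simple_part by rewrite (subsetP CX)// Cx inE.
    by rewrite inE /loop -Cx rC Cx cards1 eqxx.
  have : rank M [set x; y] != 1.
    by apply: rank_simple_pair => //; rewrite (subsetP CX)// Cxy !inE eqxx ?orbT.
  by rewrite -Cxy rC Cxy cards2 xy eqxx.
have /card_geqP[s [s_uniq s3 sC]] := C_ge3.
pose A := [set x in s].
have A3 : #|A| = 3%N by rewrite -s3 -(card_uniqP s_uniq) cardsE.
have AC : A \subset C by apply/subsetP => x; rewrite inE => /sC.
pose S := C :\: A.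
have S3 : #|C| = (#|S| + 3)%N by rewrite -A3 -(cardsID A C) (setIidPr AC) addnC.
have SA : S :|: A = C by rewrite -[RHS](setID C A) (setIidPr AC) setUC.
have cSU (B : {set M}) : B \subset A -> #|S :|: B| = (#|S| + #|B|)%N.
  move=> BA; rewrite cardsU (_ : S :&: B = set0) ?cards0 ?subn0//.
  apply/eqP; rewrite setI_eq0 disjoint_sym disjoints_subset.
  by rewrite (subset_trans BA)// setCD subsetUr.
have SsubA (B : {set M}) : B \subset A -> (S :|: B \proper C) = (#|B| < 3)%N.
  by move=> BA; rewrite properEcard -{1}SA setUS//= S3 cSU// ltn_add2l.
pose N1 := contract S.
pose N := delete (M := N1) [set x : N1 | val x \notin A].
pose e (x : N) : M := val (val x : N1).
have e_inj : injective e by move=> x y /val_inj/val_inj.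
have eA : e @: [set: N] = A.
  apply/setP => x; apply/imsetP/idP => [[y _ ->]|xA].
    by have := valP y; rewrite inE negbK.
  have xS : x \notin S by rewrite inE xA.
  have xN : (exist _ x xS : N1) \notin [set x : N1 | val x \notin A].
    by rewrite inE negbK.
  by exists (exist _ (exist _ x xS) xN : N).
have rN (T : {set N}) : rank N T = rank M (S :|: e @: T) - rank M S.
  by rewrite /= -imset_comp.
apply: noU; exists N; first exact/minor_delete/minor_contract/minor_refl.
apply: isomorphic_uniform => [|T].
  by rewrite -cardsT -(card_imset _ e_inj) eA.
have eTA : e @: T \subset A by rewrite -eA imsetS ?subsetT.
have rS : rank M S = #|S|%:R.
  by rewrite indep// -[S]setU0 SsubA ?sub0set ?cards0.
(* Fewer than three elements together with [S] form a proper, hence independent, subset of [C]; all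
   three give rank [#|C| - 1 - #|S| = 2]. *)
rewrite rN rS; have [T3|T3] := ltnP #|T| 3.
  have STC : S :|: e @: T \proper C by rewrite SsubA// card_imset.
  by rewrite indep// cSU// card_imset// natrD addrAC subrr add0r (minn_idPr _).
have -> : e @: T = A by apply/eqP; rewrite eqEcard eTA A3 card_imset.
by rewrite SA rC S3 addn3 (minn_idPl (ltnW T3)) -natrB ?leqW// -addn2 addKn.
Qed.

End Matroid.

(* Functions in the group below vanish off [D] and factor through the retraction
   [t], so those that are trivial on [S] correspond to arbitrary functions
   supported on [t @: D] minus [t @: (S :&: D)]. *)
Lemma retraction_representable (R : realType) (hT : finGroupType)
    (M : polymatroid R) (D : {set M}) (t : M -> M) :
  (1 < #|[set: hT]|)%N -> {in D, forall x, t x \in D} ->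
  {in D, forall x, t (t x) = t x} ->
  (forall S, rank M S = #|t @: (S :&: D)|%:R) -> representable hT M.
Proof.
move=> q1 tD tt rM; have q0 : (0 < #|[set: hT]|)%N by apply: ltn_trans q1.
pose H := [set h : {ffun M -> hT} |
  [forall x, h x == if x \in D then h (t x) else 1%g]].
have HP (h : {ffun M -> hT}) :
    reflect (forall x, h x = if x \in D then h (t x) else 1%g) (h \in H).
  by rewrite inE; exact: eqfunP.
have gH : group_set H.
  apply/group_setP; split=> [|g h /HP Hg /HP Hh]; apply/HP => x.
    by rewrite !ffunE if_same.
  by rewrite !ffunE Hg Hh; case: ifP => _; rewrite ?mulg1.
exists M, (Group gH), id; split=> [|S]; first by exists id.
rewrite imset_id rank_group rM.
(* Functions supported on [U] extend along [t] to [D] without loss, every point of [U] being some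
   [t y]. *)
have ext_inj (U : {set M}) : U \subset t @: D ->
    {in pffun_on 1%g (mem U) (mem [set: hT]) &,
      injective (fun g : {ffun M -> hT} =>
        [ffun x => if x \in D then g (t x) else 1%g] : {ffun M -> hT})}.
  move=> UtD g h /pffun_onP[/supportP g1 _] /pffun_onP[/supportP h1 _] gh.
  apply/ffunP => x; have [xU|xU] := boolP (x \in U); last by rewrite g1 ?h1.
  have /imsetP[y yD xy] := subsetP UtD _ xU.
  by move/ffunP/(_ y): gh; rewrite !ffunE yD xy.
have cK (S' : {set M}) : #|coord_ker (Group gH) S'| =
    (#|[set: hT]| ^ (#|t @: D| - #|t @: (S' :&: D)|))%N.
  set Y := t @: (S' :&: D).
  have YtD : Y \subset t @: D by rewrite imsetS// subsetIr.
  rewrite -(setIidPr YtD) -cardsD -(card_pffun_on 1%g).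
  rewrite -(card_in_imset (ext_inj _ (subsetDl _ Y))).
  apply: eq_card => h; apply/coord_kerP/imsetP; last first.
    move=> [g /pffun_onP[/supportP g1 _] ->]; split=> [|x xS].
      by apply/HP => x; rewrite !ffunE; case: ifP => // xD; rewrite tD// tt.
    rewrite ffunE; case: ifP => // xD; apply: g1.
    rewrite -[_ \notin _]/(t x \notin (t @: D) :\: Y) in_setD negb_and negbK.
    by apply/orP; left; apply: imset_f; apply/setIP.
  move=> [/HP Hh h1].
  exists [ffun x => if x \in t @: D then h x else 1%g].
    apply/pffun_onP; split=> // [|y _]; last exact: in_setT.
    apply/supportP => x; rewrite inE negb_and negbK ffunE; case: ifP => //=.
    move=> xt; rewrite orbF => /imsetP[y /setIP[yS yD] ->].
    by have := h1 _ yS; rewrite Hh yD.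
  apply/ffunP => x; rewrite !ffunE Hh; case: ifP => // xD.
  by rewrite imset_f.
(* The order of the whole group is the kernel count for the empty set. *)
have -> : #|Group gH| = (#|[set: hT]| ^ #|t @: D|)%N.
  rewrite -[X in (_ ^ X)%N]subn0 -(cards0 M) -(imset0 t) -(set0I D) -cK.
  apply: eq_card => h; apply/idP/coord_kerP => [|[]//].
  by move=> hH; split=> // x; rewrite inE.
rewrite cK !natrX !lnXn ?ltr0n// -mulrnBr ?leq_subr// subKn; last first.
  by rewrite subset_leq_card// imsetS// subsetIr.
by rewrite -[X in X / _]mulr_natl mulfK// gt_eqF// ln_gt0// ltr1n.
Qed.

(** The four implications form a cycle. The last condition excludes trivial groups, over which
    [ln 1 = 0] makes every rank 0, so that only matroids of loops are represented. *)
Theorem theorem5p1 (R : realType) (gT : finGroupType)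
    (gT_nonabelian : ~~ abelian [set: gT])
    (M : polymatroid R) (M_matroid : is_matroid M) :
  [<-> representable gT M;
       ~ has_minor M (uniform R 2 3);
       (exists n : nat, isomorphic (simplification M) (uniform R n n)) \/
         (forall x : M, loop x);
       forall hT : finGroupType, (1 < #|[set: hT]|)%N -> representable hT M].
Proof.
have rank_delete (S : {set M}) (T : {set delete S}) :
  rank (delete S) T = rank M (val @: T) by [].
tfae.
- move=> /representable_coordinatized cM [N MN NU].
  move/negP: gT_nonabelian; apply.
  exact: coordinatized_U23_abelian
    (coordinatized_isomorphic NU (coordinatized_minor MN cM)).
- move=> noU; left; exists #|simplification M|; apply: isomorphic_uniform => // T.
  rewrite rank_delete (simple_part_free M_matroid noU).
    by rewrite card_imset ?(minn_idPr _) ?max_card//; exact: val_inj.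
  apply/subsetP => _ /imsetP[x _ ->].
  by have := valP x; rewrite inE negbK.
- move=> simpleM hT hT1.
  (* Either alternative makes [simple_part] independent; when all elements are loops it is empty. *)
  have free (S : {set M}) : S \subset simple_part M -> rank M S = #|S|%:R.
    move=> SX; case: simpleM => [[n [f [f_bij fr]]]|loops]; last first.
      suff -> : S = set0 by rewrite rank0 cards0.
      apply/setP => x; rewrite inE; apply/negP => /(subsetP SX).
      by move=> /(simple_part_nonloop M_matroid); rewrite inE loops.
    pose T : {set simplification M} := val @^-1: S.
    have TS : val @: T = S.
      apply/setP => x; apply/imsetP/idP => [[y + ->]|xS]; first by rewrite inE.
      have xX : x \notin ~: simple_part M by rewrite inE negbK (subsetP SX).
      by exists (exist _ x xX : simplification M); rewrite ?inE.
    rewrite -TS -rank_delete -fr /= (minn_idPr _).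
      by rewrite !card_imset//; [exact: val_inj|exact: bij_inj].
    by rewrite -[leqRHS](card_ord n) max_card.
  apply: (@retraction_representable _ _ _ (nonloops M) (@simple_repr _ M)) => //.
  + by move=> x xD; apply/(simple_part_nonloop M_matroid)/simple_repr_part.
  + by move=> x xD; rewrite simple_repr_id// simple_repr_part.
  + move=> S; rewrite -free ?rank_simple_image//.
    by apply/subsetP => _ /imsetP[x /setIP[_ xD] ->]; exact: simple_repr_part.
(* A nonabelian group is nontrivial, so the last condition applies to [gT] itself. *)
- apply; rewrite ltnNge; apply: contra gT_nonabelian => /card_le1_trivg->.
  exact: abelian1.
Qed.
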